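(* Let $V$ be a finite set with $n=|V|$, and let $C=(c_{vw})_{v,w\in V}$ be a real nonnegative symmetric matrix with only zeros on its diagonal whose off-diagonal entries satisfy $c_{xz}\ge\min\{c_{xy},c_{yz}\}$ for all pairwise distinct $x,y,z\in V$. Let $M\coloneqq\max\{c_{vw}: v,w\in V\}$. Then the energy of $C$ is at most $2(n-1)M$. Furthermore, $M(J-I)$ is the only such matrix attaining this bound.
   Context: The energy of a real symmetric matrix with eigenvalues $\lambda_1,\dots,\lambda_n$ is $\sum_{i=1}^n|\lambda_i|$. $J$ denotes the all-ones $V\times V$ matrix and $I$ the identity matrix. *)

(* Defs.v *)
(* MathComp, with [R : realType] as the field of real numbers. *)
From mathcomp Require Import all_boot all_order all_algebra.
From mathcomp Require Import polyrcf.
From mathcomp Require Import reals.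

Set Implicit Arguments.
Unset Strict Implicit.
Unset Printing Implicit Defensive.

Import Order.TTheory GRing.Theory Num.Theory.
Local Open Scope ring_scope.

(* [rootsR] lists the distinct real roots, so each one is repeated according to
   its multiplicity in the characteristic polynomial. For a symmetric matrix
   this is the whole spectrum, as the characteristic polynomial splits over R. *)
Definition eigenvalues (R : realType) (n : nat) (A : 'M[R]_n) : seq R :=
  flatten [seq nseq (mup x (char_poly A)) x | x <- rootsR (char_poly A)].

Definition energy (R : realType) (n : nat) (A : 'M[R]_n) : R :=
  \sum_(x <- eigenvalues A) `|x|.

(* A V x V matrix is a function of two arguments in V; [mx_of c] is the same
   matrix with V enumerated as {0, ..., #|V| - 1}. *)
Definition mx_of (R : realType) (V : finType) (c : V -> V -> R) : 'M[R]_#|V| :=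
  \matrix_(i, j) c (enum_val i) (enum_val j).

Definition ultra_mx (R : realType) (V : finType) (c : V -> V -> R) : Prop :=
  [/\ forall v w, 0 <= c v w,
      forall v w, c v w = c w v,
      forall v, c v v = 0
    & forall x y z, x != y -> y != z -> x != z ->
        Num.min (c x y) (c y z) <= c x z].

(* The maximum of the entries, when these are nonnegative and V is nonempty:
   starting the maximum at 0 only matters for empty V, where it yields 0. *)
Definition max_entry (R : realType) (V : finType) (c : V -> V -> R) : R :=
  \big[Num.max/0]_(v : V) \big[Num.max/0]_(w : V) c v w.

Lemma eigenvalues_perm (R : realType) (n : nat) (A : 'M[R]_n) (s : seq R) :
  char_poly A = \prod_(x <- s) ('X - x%:P) -> perm_eq (eigenvalues A) s.
Proof.
move=> pE; have p_neq0 := monic_neq0 (char_poly_monic A).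
have rootsE x : (x \in rootsR (char_poly A)) = (x \in s).
  have /(_ x) := roots_on_rootsR p_neq0.
  by rewrite in_itv /= => <-; rewrite pE root_prod_XsubC.
have uniq_r : uniq (rootsR (char_poly A)) by exact: uniq_roots.
apply/allP => x _ /=; apply/eqP.
rewrite /eigenvalues count_flatten -map_comp sumnE big_map.
under eq_bigr => y _ do rewrite /= count_nseq pE mu_prod_XsubC /=.
have [xs|xs] := boolP (x \in s).
  rewrite (bigD1_seq x) ?rootsE //= eqxx mul1n big1 ?addn0 // => y.
  by move=> /negbTE ->.
rewrite (count_memPn xs) big1_seq // => y; rewrite rootsE /= => ys.
by have [yx|] := eqVneq y x; [rewrite -yx ys in xs | rewrite mul0n].
Qed.

Lemma energyE (R : realType) (n : nat) (A : 'M[R]_n) (s : seq R) :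
  char_poly A = \prod_(x <- s) ('X - x%:P) -> energy A = \sum_(x <- s) `|x|.
Proof. by move=> pE; apply/perm_big/eigenvalues_perm. Qed.

(* Main.v *)
(* The matrix [C + M I] satisfies the ultrametric inequality, so it is positive
   semidefinite: subtracting its least positive entry from its positive entries
   removes a positive multiple of the matrix of a partial equivalence relation,
   and leaves a matrix of the same kind with fewer positive entries. Hence the
   eigenvalues of [C] are at least [- M]; they sum to [tr C = 0], and these
   two facts bound the sum of their absolute values by [2 (n - 1) M]. In case of equality
   with [M > 0] they are [- M], [n - 1] times, and [(n - 1) M], so that
   [tr (C^2) = n (n - 1) M^2], which forces every off-diagonal entry to be [M]. *)
Require Import Defs.
From mathcomp Require Import all_boot all_order all_algebra.
From mathcomp Require Import complex.
From mathcomp Require Import ring lra.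
From mathcomp Require Import reals.

Set Implicit Arguments.
Unset Strict Implicit.
Unset Printing Implicit Defensive.

Import Order.TTheory GRing.Theory Num.Theory.
Local Open Scope ring_scope.

(** * Spectrum of a real symmetric matrix *)

Lemma char_poly_similar (F : fieldType) (n : nat) (P A : 'M[F]_n) :
  P \in unitmx -> char_poly (invmx P *m A *m P) = char_poly A.
Proof.
move=> Pu; rewrite /char_poly.
have -> : char_poly_mx (invmx P *m A *m P) =
    map_mx polyC (invmx P) *m char_poly_mx A *m map_mx polyC P.
  rewrite /char_poly_mx mulmxBr mulmxBl !map_mxM -mulmxA scalar_mxC mulmxA.
  by congr (_ - _); rewrite -mulmxA -map_mxM mulVmx // map_mx1 mulmx1.
by rewrite !det_mulmx mulrC mulrA -det_mulmx -map_mxM mulmxV // map_mx1 det1 mul1r.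
Qed.

(** Over the complex extension [A] is Hermitian, hence unitarily diagonalizable with a real
    diagonal; injectivity of the embedding brings the identities back to [R]. *)
Lemma symmetric_spectrum (R : rcfType) (n : nat) (A : 'M[R]_n) : A^T = A ->
  exists s : seq R, [/\ char_poly A = \prod_(x <- s) ('X - x%:P), size s = n,
    \sum_(x <- s) x = \tr A & \sum_(x <- s) x ^+ 2 = \tr (A *m A)].
Proof.
move=> symA; pose toC := real_complex R; pose B := map_mx toC A.
have hB : B \is hermsymmx.
  apply: realsym_hermsym; last first.
    by apply/mxOverP => i j; rewrite mxE; apply/complex_realP; exists (A i j).
  by apply/is_hermitianmxP; rewrite expr0 scale1r map_mx_id // map_trmx symA.
have /orthomx_spectralP BE := hermitian_normalmx hB.
have /mxOverP dreal := hermitian_spectral_diag_real hB.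
have Pu := spectral_unit B.
move: (spectralmx B) (spectral_diag B) BE dreal Pu => P D BE dreal Pu.
pose d j := complex.Re (D 0 j).
have dE j : toC (d j) = D 0 j by exact/RRe_real/dreal.
exists [seq d j | j <- enum 'I_n]; split.
- apply: (map_poly_inj toC); rewrite map_char_poly -/B BE char_poly_similar //.
  rewrite char_poly_trig; last by apply/diag_mx_is_trig.
  rewrite big_map big_enum rmorph_prod /=; apply: eq_bigr => i _.
  by rewrite mxE eqxx mulr1n rmorphB /= map_polyX map_polyC -dE.
- by rewrite size_map size_enum_ord.
- apply: (fmorph_inj toC); rewrite -trace_map_mx -/B BE -mulmxA mxtrace_mulC.
  rewrite mulmxK // mxtrace_diag big_map big_enum rmorph_sum /=.
  by apply: eq_bigr => i _; rewrite -dE.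
- apply: (fmorph_inj toC); rewrite -trace_map_mx map_mxM -/B BE.
  rewrite !mulmxA mulmxK // mxtrace_mulC !mulmxA mulmxV // mul1mx.
  rewrite mulmx_diag mxtrace_diag big_map big_enum rmorph_sum /=.
  by apply: eq_bigr => i _; rewrite mxE rmorphXn -dE expr2.
Qed.

(** * Positive semidefiniteness of ultrametric matrices *)

(* Weighting each [z] by the inverse size of its class writes the form as a sum
   of squares. *)
Lemma per_psd (R : realFieldType) (V : finType) (e : rel V) (u : V -> R) :
  symmetric e -> transitive e ->
  0 <= \sum_x \sum_y (e x y)%:R * (u x * u y).
Proof.
(* [e] need not be reflexive: a [z] with empty class gets weight 0, the inverse of 0 being 0. *)
move=> eC eT; pose w x : R := (#|[set z | e z x]|%:R)^-1.
have -> : \sum_x \sum_y (e x y)%:R * (u x * u y) =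
    \sum_z w z * (\sum_x (e z x)%:R * u x) ^+ 2.
  under [RHS]eq_bigr => z _.
    rewrite expr2 big_distrlr /= mulr_sumr.
    under eq_bigr => x _ do rewrite mulr_sumr.
    over.
  rewrite [RHS]exchange_big /=; apply: eq_bigr => x _.
  rewrite [RHS]exchange_big /=; apply: eq_bigr => y _.
  have [exy|nexy] := boolP (e x y); last first.
    rewrite mul0r big1 // => z _.
    have [ezx|] := boolP (e z x); last by rewrite !mul0r mulr0.
    have [ezy|] := boolP (e z y); last by rewrite mul0r !mulr0.
    by case/negP: nexy; rewrite eC in ezx; exact: eT ezy.
  have cE z : e z x -> w z = w x.
    move=> ezx; rewrite /w; congr (_%:R^-1); apply: eq_card => t; rewrite !inE.
    apply/idP/idP => [etz|etx]; [exact: eT ezx | rewrite eC in ezx; exact: eT ezx].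
  transitivity (\sum_(z | e z x) w x * (u x * u y)); last first.
    rewrite big_mkcond /=; apply: eq_bigr => z _.
    have [ezx|] := boolP (e z x); last by rewrite !mul0r mulr0.
    by rewrite cE // (eT _ _ _ ezx exy) !mul1r.
  rewrite sumr_const -mulrnAl -[w x *+ _]mulr_natl.
  have -> : #|[pred z | e z x]| = #|[set z | e z x]|.
    by apply: eq_card => z; rewrite !inE.
  (* The class of [x] contains [x] itself, since [e x y] and [e y x] hold. *)
  rewrite /w mulfV // pnatr_eq0 -lt0n; apply/card_gt0P; exists x.
  by rewrite inE; move: (exy); rewrite eC; exact: eT.
by apply: sumr_ge0 => z _; rewrite mulr_ge0 ?sqr_ge0 // invr_ge0 ler0n.
Qed.

Lemma ultrametric_psd (R : realFieldType) (V : finType) (b : V -> V -> R)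
    (u : V -> R) :
  (forall x y, 0 <= b x y) -> (forall x y, b x y = b y x) ->
  (forall x y z, Num.min (b x y) (b y z) <= b x z) ->
  0 <= \sum_x \sum_y b x y * (u x * u y).
Proof.
have [k] := ubnP #|[set p | 0 < b p.1 p.2]|.
elim: k => // k IHk in b *; rewrite ltnS => bk b_ge0 bC bU.
have [p0 p0_gt|noP] := pickP [pred p | 0 < b p.1 p.2]; last first.
  rewrite big1 // => x _; rewrite big1 // => y _.
  have := noP (x, y); rewrite /= lt_def b_ge0 andbT => /negbFE/eqP ->.
  by rewrite mul0r.
have [[x0 y0] /= m_gt m_min] := arg_minP (fun p => b p.1 p.2) p0_gt.
set m := b x0 y0 in m_gt m_min.
(* Truncation at 0 keeps zero entries at 0 and, being monotone, preserves the ultrametric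
   inequality. *)
pose b' x y := Num.max (b x y - m) 0.
have bE x y : b x y = m * (0 < b x y)%R%:R + b' x y.
  have [xy|xy] := boolP (0 < b x y).
    have := m_min (x, y) xy; rewrite /b' /= => le_m.
    by rewrite max_l ?subr_ge0 // mulr1; ring.
  have b0 : b x y = 0 by apply/eqP; rewrite eq_le b_ge0 leNgt xy.
  by rewrite /b' b0 mulr0 add0r max_r // sub0r oppr_le0 ltW.
under eq_bigr => x _.
  under eq_bigr => y _ do rewrite bE mulrDl -mulrA.
  rewrite big_split /= -mulr_sumr; over.
rewrite big_split /= -mulr_sumr addr_ge0 //.
  rewrite mulr_ge0 ?(ltW m_gt) //.
  (* Positivity is transitive because a minimum of two positive entries is positive. *)
  apply: (@per_psd _ _ (fun x y => 0 < b x y)) => [x y|y x z xy yz] /=.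
    by rewrite bC.
  by apply: lt_le_trans (bU x y z); rewrite lt_min xy.
apply: IHk => [|x y|x y|x y z].
- apply: leq_trans bk; apply/proper_card/properP; split.
    apply/subsetP => -[x y]; rewrite !inE /= /b' lt_max ltxx orbF subr_gt0.
    exact: lt_trans.
  (* The minimal positive entry itself drops to 0, so the count strictly decreases. *)
  by exists (x0, y0); rewrite !inE //= /b' subrr maxxx ltxx.
- by rewrite /b' le_max lexx orbT.
- by rewrite /b' bC.
- have := bU x y z; rewrite /b' !ge_min => /orP[] h; apply/orP; [left|right].
    by rewrite ge_max !le_max lerD2r h lexx orbT.
  by rewrite ge_max !le_max lerD2r h lexx orbT.
Qed.

(** * Lower bound on the eigenvalues *)

Section ZeroDiagonalUltrametric.
Context (R : realType) (V : finType) (c : V -> V -> R).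
Local Notation M := (max_entry c).

Lemma le_max_entry v w : c v w <= M.
Proof.
apply: le_trans (le_bigmax _ (fun v => \big[Num.max/0]_w c v w) v).
exact: le_bigmax.
Qed.

Lemma max_entry_le (m : R) : 0 <= m -> (forall v w, c v w <= m) -> M <= m.
Proof. by move=> m0 cm; do 2 (apply: bigmax_le => // ? _). Qed.

Lemma max_entry_ge0 : 0 <= M.
Proof. exact: bigmax_ge_id. Qed.

Lemma max_entry_void : #|V| = 0%N -> M = 0.
Proof. by move=> V0; apply: big_pred0 => v; have := card0_eq V0 v. Qed.

Hypothesis ultra_c : ultra_mx c.

Lemma ultra_quadratic_ge (u : V -> R) :
  - M * \sum_x u x ^+ 2 <= \sum_x \sum_y c x y * (u x * u y).
Proof.
have [c0 cC cD cU] := ultra_c.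
(* With the maximum on the diagonal, the inequality extends to triples with repetitions. *)
pose b x y := if x == y then M else c x y.
have /(_ u) : forall u, 0 <= \sum_x \sum_y b x y * (u x * u y).
  move=> {}u; apply: ultrametric_psd => [x y|x y|x y z]; rewrite /b.
  - by case: ifP => // _; exact: max_entry_ge0.
  - by rewrite eq_sym cC.
  - have [->|xy] := eqVneq x y; first by rewrite ge_min lexx orbT.
    have [<-|yz] := eqVneq y z; first by rewrite (negPf xy) ge_min lexx.
    have [_|xz] := eqVneq x z; first by rewrite ge_min le_max_entry.
    exact: cU.
have bE x : \sum_y b x y * (u x * u y) =
    M * u x ^+ 2 + \sum_y c x y * (u x * u y).
  rewrite (bigD1 x) //= [in RHS](bigD1 x) //= /b eqxx cD mul0r add0r expr2.
  by congr (_ + _); apply: eq_bigr => y yx; rewrite eq_sym (negPf yx).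
under eq_bigr do rewrite bE.
rewrite big_split /= -mulr_sumr => h.
by rewrite mulNr -subr_ge0 opprK addrC.
Qed.

Lemma mx_of_sym : (mx_of c)^T = mx_of c.
Proof. by have [_ cC _ _] := ultra_c; apply/matrixP => i j; rewrite !mxE cC. Qed.

Lemma mx_of_trace : \tr (mx_of c) = 0.
Proof. by have [_ _ cD _] := ultra_c; apply: big1 => i _; rewrite mxE cD. Qed.

(** On an eigenvector the quadratic form is [a] times the sum of squares, a positive number that
    cancels from the lower bound. *)
Lemma eigenvalue_ge (a : R) : eigenvalue (mx_of c) a -> - M <= a.
Proof.
case/eigenvalueP => v va v_neq0; pose u x := v 0 (enum_rank x).
have uE x : \sum_y c x y * u y = a * u x.
  have [_ cC _ _] := ultra_c.
  have /rowP/(_ (enum_rank x)) := va; rewrite !mxE => <-.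
  rewrite (reindex enum_rank) /=; last by apply: onW_bij; exact: enum_rank_bij.
  by apply: eq_bigr => y _; rewrite mxE !enum_rankK mulrC cC.
have := ultra_quadratic_ge u.
under [X in _ <= X]eq_bigr => x _.
  under eq_bigr => y _ do rewrite mulrCA.
  rewrite -mulr_sumr uE mulrCA -expr2; over.
rewrite -mulr_sumr ler_pM2r // lt_def sumr_ge0 ?andbT; last first.
  by move=> x _; exact: sqr_ge0.
apply: contra v_neq0; rewrite psumr_eq0 => [/allP u0|x _]; last exact: sqr_ge0.
apply/eqP/rowP => i; rewrite mxE; apply/eqP.
by have := u0 (enum_val i) (mem_index_enum _); rewrite sqrf_eq0 /u enum_valK.
Qed.

End ZeroDiagonalUltrametric.

(** * Absolute sums of numbers with zero sum and a lower bound *)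

Section ZeroSum.
Context (R : realFieldType) (M : R) (s : seq R).
Hypotheses (M_ge0 : 0 <= M) (s_neq0 : s != [::]) (sum0 : \sum_(x <- s) x = 0).
Hypothesis s_ge : forall x, x \in s -> - M <= x.

Lemma zero_sum_has_ge0 : has (>= 0) s.
Proof.
apply/negPn/negP => /hasPn neg; move: sum0 s_neq0 neg.
case: (s) => // y t; rewrite big_cons => + _ neg.
have y_lt0 : y < 0 by rewrite ltNge; apply: neg; rewrite mem_head.
suff : y + \sum_(x <- t) x < 0 by move=> /[swap] ->; rewrite ltxx.
rewrite ltr_wnDr // big_seq sumr_le0 // => x xt.
by apply: ltW; rewrite ltNge; apply: neg; rewrite inE xt orbT.
Qed.

(* A nonnegative member [x0] of [s] satisfies [|x0| = x0], and each other one
   [|x| <= x + 2 M], with equality only at [x = - M]. *)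
Lemma sum_norm_le : \sum_(x <- s) `|x| <= 2 * ((size s)%:R - 1) * M /\
  (0 < M -> \sum_(x <- s) `|x| = 2 * ((size s)%:R - 1) * M ->
   \sum_(x <- s) x ^+ 2 = (size s)%:R * ((size s)%:R - 1) * M ^+ 2).
Proof.
have /hasP[/= x0 x0s x0_ge] := zero_sum_has_ge0.
have pe := perm_to_rem x0s.
have splitE (F : R -> R) :
    \sum_(x <- s) F x = F x0 + \sum_(x <- rem x0 s) F x.
  by rewrite (perm_big _ pe) /= big_cons.
move: sum0; rewrite !splitE (perm_size pe).
have t_ge x : x \in rem x0 s -> - M <= x by move/mem_rem; exact: s_ge.
move: (rem x0 s) t_ge => t t_ge sumt.
have tE : \sum_(x <- t) (x + 2 * M) = - x0 + (size t)%:R * (2 * M).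
  rewrite big_split /= big_const_seq count_predT iter_addr addr0.
  by rewrite -[_ *+ size t]mulr_natl; move: sumt; lra.
have norm_le x : x \in t -> `|x| <= x + 2 * M.
  by move=> /t_ge xM; rewrite ler_norml; apply/andP; move: M_ge0; split; lra.
have -> : (size (x0 :: t))%:R = (size t)%:R + 1 :> R by rewrite /= -addn1 natrD.
rewrite addrK ger0_norm //; split.
  have : \sum_(x <- t) `|x| <= \sum_(x <- t) (x + 2 * M).
    by rewrite big_seq [leRHS]big_seq; apply: ler_sum.
  by rewrite tE; lra.
move=> M_gt0 sum_eq.
(* Equality makes the total slack vanish, and every slack is nonnegative. *)
have : \sum_(x <- t) (x + 2 * M - `|x|) = 0 by rewrite sumrB tE; lra.
move=> /eqP; rewrite big_seq psumr_eq0 => [/allP tM|x xt]; last first.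
  by rewrite subr_ge0 norm_le.
have {}tM x : x \in t -> x = - M.
  move=> xt; have := tM x xt; rewrite xt /= => /eqP.
  (* A nonnegative [x] would have slack [2 * M], which is positive. *)
  by case: ger0P => _; lra.
have -> : \sum_(x <- t) x ^+ 2 = (size t)%:R * M ^+ 2.
  rewrite big_seq (eq_bigr (fun=> M ^+ 2)); last by move=> x /tM ->; rewrite sqrrN.
  by rewrite -big_seq big_const_seq count_predT iter_addr addr0 mulr_natl.
have -> : x0 = (size t)%:R * M.
  have : \sum_(x <- t) x = (size t)%:R * - M.
    rewrite big_seq (eq_bigr (fun=> - M)) => [|x /tM //].
    by rewrite -big_seq big_const_seq count_predT iter_addr addr0 mulr_natl.
  by lra.
by ring.
Qed.

End ZeroSum.

(** * Attainment of the bound and uniqueness *)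

(** For [n = 0] the right side would be [- 2 * m] while the energy is 0, hence the assumption on
    [n]. *)
Lemma energy_complete (R : realType) (n : nat) (m : R) : (0 < n)%N -> 0 <= m ->
  energy (m *: (const_mx 1 - 1%:M) : 'M_n) = 2 * (n%:R - 1) * m.
Proof.
move=> n_gt0 m_ge0; set A := m *: _.
have n_ge1 : 1 <= n%:R :> R by rewrite ler1n.
have AE i j : A i j = m - m * (i == j)%:R by rewrite !mxE mulrBr mulr1.
have symA : A^T = A by apply/matrixP => i j; rewrite mxE !AE eq_sym.
have [s [pE size_s sum_s _]] := symmetric_spectrum symA.
have sum0 : \sum_(x <- s) x = 0.
  by rewrite sum_s; apply: big1 => i _; rewrite AE eqxx mulr1 subrr.
rewrite (energyE pE).
have n_neq0 : n%:R != 0 :> R by rewrite pnatr_eq0 -lt0n.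
apply: (mulfI n_neq0).
(* The only eigenvalues are [- m] and [(n - 1) m], on which [n |x|] agrees
   with the affine function below; its sum only depends on the trace. *)
have normE x : x \in s -> n%:R * `|x| = (n%:R - 2) * x + 2 * (n%:R - 1) * m.
  rewrite -root_prod_XsubC -pE -eigenvalue_root_char => /eigenvalueP[v vA v0].
  have vE i : (x + m) * v 0 i = m * \sum_j v 0 j.
    have /rowP/(_ i) := vA; rewrite !mxE mulrDl => <-.
    under eq_bigr do rewrite AE mulrBr.
    rewrite sumrB (bigD1 i) //= [X in _ - X](bigD1 i) //= eqxx mulr1.
    rewrite [X in _ - (_ + X)]big1 => [|j ji]; last by rewrite (negPf ji) !mulr0.
    by rewrite [in RHS](bigD1 i) //= mulrDr mulr_sumr addr0 mulrC
      (eq_bigr (fun j => m * v 0 j)) => [|j _]; [ring | rewrite mulrC].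
  have [xm|xm] := eqVneq (x + m) 0.
    have -> : x = - m by apply/eqP; rewrite -addr_eq0 xm.
    by rewrite normrN ger0_norm //; ring.
  (* For an eigenvalue other than [- m] the eigenvector is constant, so its equation at a nonzero
     entry reads [x + m = n * m]. *)
  have v_const i : v 0 i = m * (\sum_j v 0 j) / (x + m).
    by rewrite -(vE i) mulrAC mulfV // mul1r.
  have [i vi0] : exists i, v 0 i != 0.
    apply/existsP; apply: contraNT v0; rewrite negb_exists => /forallP vi0.
    by apply/eqP/rowP => i; rewrite mxE; apply/eqP/negPn/vi0.
  have xE : x = (n%:R - 1) * m.
    have : (x + m) * v 0 i = m * n%:R * v 0 i.
      rewrite {1}vE (eq_bigr (fun=> v 0 i)) => [|j _].
        by rewrite sumr_const card_ord -[v 0 i *+ n]mulr_natl mulrA.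
      by rewrite !v_const.
    by move/(mulIf vi0) => xmE; rewrite mulrBl mul1r mulrC -xmE addrK.
  by rewrite xE ger0_norm ?mulr_ge0 ?subr_ge0 //; ring.
rewrite mulr_sumr big_seq (eq_bigr _ normE) -big_seq big_split /= -mulr_sumr.
rewrite sum0 mulr0 add0r big_const_seq count_predT iter_addr addr0 size_s.
by rewrite -[LHS]mulr_natl.
Qed.

Lemma ultra_energy (R : realType) (V : finType) (c : V -> V -> R) :
  ultra_mx c ->
  energy (mx_of c) <= 2 * (#|V|%:R - 1) * max_entry c /\
  (energy (mx_of c) = 2 * (#|V|%:R - 1) * max_entry c ->
   forall v w, v != w -> c v w = max_entry c).
Proof.
move=> hc; have [c0 cC cD _] := hc; set M := max_entry c.
have [s [pE size_s sum_s sum_sqr]] := symmetric_spectrum (mx_of_sym hc).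
rewrite (energyE pE).
(* For empty [V] the factor [#|V| - 1] is negative, but the maximum is 0. *)
have [V0|Vn0] := posnP #|V|.
  split=> [|_ v]; last by have := card0_eq V0 v.
  have -> : M = 0 by exact: max_entry_void.
  by rewrite (size0nil (etrans size_s V0)) big_nil mulr0.
have s_neq0 : s != [::] by rewrite -size_eq0 size_s -lt0n.
have s_ge x : x \in s -> - M <= x.
  by rewrite -root_prod_XsubC -pE -eigenvalue_root_char; exact: eigenvalue_ge.
rewrite (mx_of_trace hc) in sum_s.
have := sum_norm_le (max_entry_ge0 c) s_neq0 sum_s s_ge.
rewrite size_s => -[le_s eq_s]; split=> // energy_eq v w vw.
have [M0|M_neq0] := eqVneq M 0.
  by apply/eqP; rewrite M0 eq_le c0 andbT -M0 le_max_entry.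
have M_gt0 : 0 < M by rewrite lt_def M_neq0 max_entry_ge0.
have sqr_le x y : 0 <= M ^+ 2 - c x y ^+ 2.
  by rewrite subr_ge0 ler_sqr ?nnegrE ?c0 ?max_entry_ge0 ?le_max_entry.
have traceE : \tr (mx_of c *m mx_of c) = \sum_x \sum_(y | y != x) c x y ^+ 2.
  rewrite /mxtrace (reindex enum_rank) /=; last first.
    by apply: onW_bij; exact: enum_rank_bij.
  apply: eq_bigr => x _; rewrite mxE (reindex enum_rank) /=; last first.
    by apply: onW_bij; exact: enum_rank_bij.
  rewrite (bigD1 x) //= !mxE !enum_rankK cD mul0r add0r.
  by apply: eq_bigr => y _; rewrite !mxE !enum_rankK (cC y x) expr2.
(* The trace of the square equals [n * (n - 1) * M ^+ 2], so these nonnegative differences sum to 0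
   and each vanishes. *)
have : \sum_x \sum_(y | y != x) (M ^+ 2 - c x y ^+ 2) == 0.
  under eq_bigr => x _ do rewrite sumrB sumr_const cardC1.
  rewrite sumrB -traceE -sum_sqr eq_s // subr_eq0 sumr_const -mulrnA.
  by rewrite -[X in X == _]mulr_natl natrM -subn1 natrB // [X in X * _]mulrC.
rewrite psumr_eq0 => [/allP/(_ v (mem_index_enum _))|x _]; last exact: sumr_ge0.
rewrite psumr_eq0 // => /allP/(_ w (mem_index_enum _)).
by rewrite eq_sym vw /= subr_eq0 eqrXn2 ?max_entry_ge0 // => /eqP.
Qed.

Theorem theorem6 (R : realType) (V : finType) (c : V -> V -> R) :
  ultra_mx c ->
  let n := #|V| in
  let M := max_entry c in
  energy (mx_of c) <= 2 * (n%:R - 1) * M /\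
  (forall d : V -> V -> R,
     [/\ ultra_mx d, max_entry d = M & energy (mx_of d) = 2 * (n%:R - 1) * M]
     <-> mx_of d = M *: (const_mx 1 - 1%:M)).
Proof.
move=> hc n M; split=> [|d]; first by have [] := ultra_energy hc.
have [_ _ cD _] := hc.
split=> [[hd dM dE]|dE].
  have [_ _ dD _] := hd; have [_ d_eq] := ultra_energy hd.
  rewrite dM in d_eq; apply/matrixP => i j; rewrite !mxE.
  have [->|ij] := eqVneq i j; first by rewrite dD subrr mulr0.
  by rewrite d_eq ?subr0 ?mulr1 // (inj_eq enum_val_inj).
have dVE v w : d v w = if v == w then 0 else M.
  have /matrixP/(_ (enum_rank v) (enum_rank w)) := dE.
  rewrite !mxE !enum_rankK (inj_eq enum_rank_inj) => ->.
  by case: eqP => _; rewrite ?subrr ?mulr0 // subr0 mulr1.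
have M_ge0 : 0 <= M := max_entry_ge0 c.
have hd : ultra_mx d.
  split=> [v w|v w|v|x y z xy yz xz]; rewrite !dVE ?eqxx //.
  - by case: ifP.
  - by rewrite eq_sym.
  - by rewrite (negPf xy) (negPf yz) (negPf xz) minxx.
have dM : max_entry d = M.
  apply/eqP; rewrite eq_le; apply/andP; split.
    by apply: max_entry_le => // v w; rewrite dVE; case: ifP.
  (* Bounding the entries of [c] by those of [d] also covers a one-element [V], where no
     off-diagonal entry exhibits [M]. *)
  apply: max_entry_le => [|v w]; first exact: max_entry_ge0.
  have [<-|vw] := eqVneq v w; first by rewrite cD max_entry_ge0.
  apply: le_trans (le_max_entry d v w).
  by rewrite dVE (negPf vw) le_max_entry.
(* For empty [V] the energy, a sum of absolute values, is squeezed between 0 and a bound equal to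
   0. *)
split=> //; have [V0|V_gt0] := posnP #|V|; last by rewrite dE energy_complete.
have M0 : M = 0 by exact: max_entry_void.
have [+ _] := ultra_energy hd; rewrite dM M0 !mulr0 => energy_le0.
by apply/le_anti; rewrite energy_le0 sumr_ge0.
Qed.
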